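(* There exist absolute constants $c,c'>0$ such that the following holds. Let $x\in\mathcal X$ be any prompt with reward model error $\varepsilon_{\mathtt{RM}}^2(x)\in(0,1]$, and let $\pi^\star$ be any comparator policy. Whenever $N\ge c\cdot\mathcal C^{\pi^\star}(x)\cdot\log\big(R_{\max}/\varepsilon_{\mathtt{RM}}(x)\big)$, the Best-of-$N$ policy $\hat\pi_{\mathtt{BoN}}$ satisfies $$J(\pi^\star;x)-J(\hat\pi_{\mathtt{BoN}};x)\le c'\left(R_{\max}\cdot\frac{\mathcal C^{\pi^\star}(x)\cdot\log\big(R_{\max}/\varepsilon_{\mathtt{RM}}(x)\big)}{N}+\sqrt{N\cdot\varepsilon_{\mathtt{RM}}^2(x)}\right).$$ In particular, for any sufficiently large absolute constants $C_1\le C_2$ there is an absolute constant $c''$ such that, as long as $C_1 T\le N\le C_2T$ with $T=\Big(\frac{R_{\max}\cdot\mathcal C^{\pi^\star}(x)\log(R_{\max}/\varepsilon_{\mathtt{RM}}(x))}{\varepsilon_{\mathtt{RM}}(x)}\Big)^{2/3}$, $$J(\pi^\star;x)-J(\hat\pi_{\mathtt{BoN}};x)\le c''\Big(R_{\max}\cdot\mathcal C^{\pi^\star}(x)\cdot\varepsilon_{\mathtt{RM}}^2(x)\cdot\log\big(R_{\max}/\varepsilon_{\mathtt{RM}}(x)\big)\Big)^{1/3}.$$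
   Context: $\mathcal X$ is a set of prompts and $\mathcal Y$ a discrete set of responses. A policy is a map $\pi:\mathcal X\to\Delta(\mathcal Y)$, $x\mapsto\pi(\cdot\mid x)$; $\pi_{\mathsf{ref}}$ is a fixed base policy. The true reward $r^\star$ and reward model $\hat r$ are functions $\mathcal X\times\mathcal Y\to[0,R_{\max}]$, $R_{\max}\ge1$. Write $J(\pi;x)=\mathbb E_{y\sim\pi(\cdot\mid x)}[r^\star(x,y)]$, $\varepsilon_{\mathtt{RM}}^2(x)=\mathbb E_{y\sim\pi_{\mathsf{ref}}(\cdot\mid x)}[(\hat r(x,y)-r^\star(x,y))^2]$ with $\varepsilon_{\mathtt{RM}}(x)\ge0$ its square root, and $\mathcal C^{\pi}(x)=\mathbb E_{y\sim\pi(\cdot\mid x)}\big[\frac{\pi(y\mid x)}{\pi_{\mathsf{ref}}(y\mid x)}\big]$ (equal to $+\infty$ if $\pi(\cdot\mid x)$ is not absolutely continuous w.r.t. $\pi_{\mathsf{ref}}(\cdot\mid x)$). Best-of-$N$ alignment ($N\ge1$ an integer): given $x$, draw $y_1,\dots,y_N$ i.i.d. from $\pi_{\mathsf{ref}}(\cdot\mid x)$ and return $y_{i^\star}$ with $i^\star\in\arg\max_{i\in[N]}\hat r(x,y_i)$; $\hat\pi_{\mathtt{BoN}}(\cdot\mid x)$ is the distribution of the returned response. *)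

(* Defs.v *)
From mathcomp Require Import all_boot all_order all_algebra.
From mathcomp Require Import boolp classical_sets functions cardinality fsbigop.
From mathcomp Require Import reals ereal topology normedtype esum exp.

Set Implicit Arguments.
Unset Strict Implicit.
Unset Printing Implicit Defensive.
Import Order.TTheory GRing.Theory Num.Theory.
Local Open Scope classical_set_scope.
Local Open Scope ring_scope.
Local Open Scope ereal_scope.

(* Probability distributions on a discrete set, given by their mass function. *)
Record distr (R : realType) (T : choiceType) := Distr {
  pmf :> T -> R ;
  pmf_ge0 : forall t, (0 <= pmf t)%R ;
  pmf_sum1 : \esum_(t in [set: T]) (pmf t)%:E = 1 }.

(* [esum] is a supremum of finite partial sums, so [expect mu f] is the
   expectation of [f] under [mu] only for nonnegative [f]; all the integrands
   below are nonnegative. *)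
Definition expect (R : realType) (T : choiceType) (mu : distr R T)
    (f : T -> \bar R) : \bar R :=
  \esum_(t in [set: T]) (mu t)%:E * f t.

Section esum_facts.
Context {R : realType}.

Lemma esumZl (T : choiceType) (c : R) (f : T -> \bar R) : (0 <= c)%R ->
  (forall t, 0 <= f t) ->
  \esum_(t in [set: T]) (c%:E * f t) = c%:E * \esum_(t in [set: T]) f t.
Proof.
move=> c0 f0.
have key (d : R) (g : T -> \bar R) : (0 <= d)%R -> (forall t, 0 <= g t) ->
    \esum_(t in [set: T]) (d%:E * g t) <= d%:E * \esum_(t in [set: T]) g t.
  move=> d0 g0; apply: ge_ereal_sup => _ [A [finA _] <-].
  rewrite -ge0_mule_fsumr//; apply: lee_wpmul2l; first by rewrite lee_fin.
  by apply: ereal_sup_ubound; exists A.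
apply/eqP; rewrite eq_le key//=.
have [c_eq0|cN0] := eqVneq c 0%R.
  by rewrite c_eq0 mul0e; apply: esum_ge0 => t _; rewrite mul0e.
have {cN0}c0 : (0 < c)%R by rewrite lt_neqAle eq_sym cN0.
rewrite -lee_pdivlMl//.
have cf0 t : 0 <= c%:E * f t by rewrite mule_ge0// lee_fin ltW.
have := key c^-1%R (fun t => c%:E * f t); rewrite invr_ge0 (ltW c0) => /(_ isT cf0).
by under eq_esum do rewrite muleA -EFinM mulVf ?gt_eqF// mul1e.
Qed.

Lemma esum_pair (T U : choiceType) (f : T -> U -> \bar R) :
  (forall t u, 0 <= f t u) ->
  \esum_(t in [set: T]) \esum_(u in [set: U]) f t u =
  \esum_(p in [set: T * U]) f p.1 p.2.
Proof.
move=> f0; rewrite (@esum_esum R T U setT (fun=> setT) f)//.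
by congr esum; apply/seteqP; split.
Qed.

Lemma esumC (T U : choiceType) (f : T -> U -> \bar R) :
  (forall t u, 0 <= f t u) ->
  \esum_(t in [set: T]) \esum_(u in [set: U]) f t u =
  \esum_(u in [set: U]) \esum_(t in [set: T]) f t u.
Proof.
move=> f0; rewrite !esum_pair//.
rewrite (@reindex_esum R (U * T)%type (T * U)%type setT setT (fun p => (p.2, p.1))) //.
split; first by [].
- by move=> [a b] [c d] _ _ /= [-> ->].
- by move=> [a b] _; exists (b, a).
Qed.

End esum_facts.

Section monad.
Context {R : realType}.

Lemma pmf_le1 (T : choiceType) (mu : distr R T) t : (mu t <= 1)%R.
Proof.
rewrite -lee_fin -(pmf_sum1 mu) -(@esum_set1 R T t (fun t => (mu t)%:E)).
  rewrite esum_mkcond; apply: le_esum => u _.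
  by case: ifPn => // _; rewrite lee_fin pmf_ge0.
by rewrite lee_fin pmf_ge0.
Qed.

Lemma dunit_ge0 (T : choiceType) (t u : T) : (0 <= (u == t)%:R :> R)%R.
Proof. by []. Qed.

Lemma dunit_sum1 (T : choiceType) (t : T) :
  \esum_(u in [set: T]) ((u == t)%:R : R)%:E = 1.
Proof.
rewrite -[RHS](@esum_set1 R T t (fun=> 1)) ?lee_fin//.
rewrite [RHS]esum_mkcond; apply: eq_esum => u _.
have [->|ut] := eqVneq u t; first by rewrite mem_set.
by rewrite memNset//; apply/eqP.
Qed.

Definition dunit (T : choiceType) (t : T) : distr R T :=
  Distr (dunit_ge0 t) (dunit_sum1 t).

Section bind.
Variables (T U : choiceType) (mu : distr R T) (k : T -> distr R U).

Definition dbind_pmf (u : U) : R := fine (expect mu (fun t => (k t u)%:E)).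

Lemma dbind_pmfE u : (dbind_pmf u)%:E = expect mu (fun t => (k t u)%:E).
Proof.
rewrite fineK// ge0_fin_numE; last first.
  by apply: esum_ge0 => t _; rewrite -EFinM lee_fin mulr_ge0// pmf_ge0.
apply: (@le_lt_trans _ _ 1); last exact: ltry.
rewrite -(pmf_sum1 mu); apply: le_esum => t _.
by rewrite -EFinM lee_fin ler_piMr ?pmf_ge0 ?pmf_le1.
Qed.

Lemma dbind_ge0 u : (0 <= dbind_pmf u)%R.
Proof.
rewrite fine_ge0//; apply: esum_ge0 => t _.
by rewrite -EFinM lee_fin mulr_ge0// pmf_ge0.
Qed.

Lemma dbind_sum1 : \esum_(u in [set: U]) (dbind_pmf u)%:E = 1.
Proof.
under eq_esum do rewrite dbind_pmfE.
rewrite esumC; last by move=> *; rewrite -EFinM lee_fin mulr_ge0// pmf_ge0.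
rewrite -(pmf_sum1 mu); apply: eq_esum => t _.
by rewrite esumZl ?pmf_ge0// ?pmf_sum1 ?mule1// => u; rewrite lee_fin pmf_ge0.
Qed.

Definition dbind : distr R U := Distr dbind_ge0 dbind_sum1.

End bind.

Section iid.
Variables (T : choiceType) (mu : distr R T).

Definition diid_pmf N (ts : N.-tuple T) : R := (\prod_(i < N) mu (tnth ts i))%R.

Lemma diid_ge0 N (ts : N.-tuple T) : (0 <= diid_pmf ts)%R.
Proof. by apply: prodr_ge0 => i _; apply: pmf_ge0. Qed.

Lemma diid_sum1 N : \esum_(ts in [set: N.-tuple T]) (diid_pmf ts)%:E = 1.
Proof.
elim: N => [|N IHN].
  have -> : [set: 0.-tuple T] = [set [tuple]].
    by apply/seteqP; split=> t _ //=; rewrite tuple0.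
  by rewrite esum_set1 /diid_pmf big_ord0// lee_fin.
rewrite (@reindex_esum R (T * N.-tuple T)%type _ setT setT
  (fun p => cons_tuple p.1 p.2)); last first.
  split; first by [].
  - move=> [a s] [b t] _ _ /= /(congr1 val) /= [-> st].
    by congr pair; apply: val_inj.
  - by move=> t _; exists (thead t, [tuple of behead t]); rewrite //= [RHS]tuple_eta; apply: val_inj.
have E (p : T * N.-tuple T) : (diid_pmf (cons_tuple p.1 p.2))%:E =
    (mu p.1)%:E * (diid_pmf p.2)%:E.
  rewrite -EFinM /diid_pmf big_ord_recl tnth0; congr (_ * _)%:E.
  by apply: eq_bigr => i _; rewrite tnthS.
under eq_esum do rewrite E.
rewrite -(@esum_pair R T (N.-tuple T) (fun t s => (mu t)%:E * (diid_pmf s)%:E)); last first.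
  by move=> t s; rewrite -EFinM lee_fin mulr_ge0// ?pmf_ge0// diid_ge0.
rewrite -(pmf_sum1 mu); apply: eq_esum => t _.
by rewrite esumZl ?pmf_ge0// ?IHN ?mule1// => s; rewrite lee_fin diid_ge0.
Qed.

Definition diid N : distr R (N.-tuple T) := Distr (@diid_ge0 N) (diid_sum1 N).

End iid.
End monad.

Definition policy (R : realType) (X : Type) (Y : choiceType) := X -> distr R Y.

Section best_of_N.
Context {R : realType} {X : Type} {Y : choiceType}.
Implicit Types (pi pi_ref : policy R X Y) (rstar rhat : X -> Y -> R).

Definition J rstar pi (x : X) : \bar R := expect (pi x) (fun y => (rstar x y)%:E).

(* Finite, hence not affected by [fine], when [rstar] and [rhat] are bounded. *)
Definition eps_RM2 pi_ref rstar rhat (x : X) : R :=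
  fine (expect (pi_ref x) (fun y => ((rhat x y - rstar x y) ^+ 2)%R%:E)).

Definition eps_RM pi_ref rstar rhat (x : X) : R :=
  Num.sqrt (eps_RM2 pi_ref rstar rhat x).

(* On the first branch, a ratio with null denominator is weighted by
   [pi x y = 0]. *)
Definition coverage pi_ref pi (x : X) : \bar R :=
  if `[< forall y, pi_ref x y = 0%R -> pi x y = 0%R >]
  then expect (pi x) (fun y => (pi x y / pi_ref x y)%R%:E)
  else +oo.

(* The index returned by Best-of-N is drawn from [tie x ys]: any tie-breaking
   rule, possibly randomized, that only selects maximizers of the reward model
   among the sampled responses (a deterministic rule is a [dunit]). *)
Definition argmax_rule rhat (N : nat) (tie : X -> N.-tuple Y -> distr R 'I_N) : Prop :=
  forall x ys i, tie x ys i != 0%R ->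
  forall j, (rhat x (tnth ys j) <= rhat x (tnth ys i))%R.

Definition BoN pi_ref (N : nat) (tie : X -> N.-tuple Y -> distr R 'I_N) :
    policy R X Y :=
  fun x => dbind (diid (pi_ref x) N) (fun ys =>
           dbind (tie x ys) (fun i => dunit (tnth ys i))).

End best_of_N.

(* Main.v *)
(* Write p, q for the base and comparator distributions and r^ for the reward
   model. Split E_q[r] - E_BoN[r] into E_q[r - r^], E_q[r^] - E_BoN[r^] and
   E_BoN[r^ - r]. The outer terms are changes of measure to p: q costs its
   coverage, and BoN has density at most N with respect to p. For the middle
   term, rejection sampling on the same N samples, with acceptance probability
   q / (q + M p), returns one of the samples, so it earns at most the r^-value of
   the Best-of-N response. It imitates q up to a bias Rmax C / M, and rejects
   everything with probability at most exp (- N / (2 M)); take M = N / (2 L). *)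
Require Import Defs.
From mathcomp Require Import all_boot all_order all_algebra.
From mathcomp Require Import boolp classical_sets reals ereal topology normedtype sequences esum exp.
From mathcomp Require Import ring lra.
Import Order.TTheory GRing.Theory Num.Theory.
Local Open Scope ring_scope.
Local Open Scope ereal_scope.

Set Implicit Arguments.
Unset Strict Implicit.
Unset Printing Implicit Defensive.

(** * Expectation of nonnegative functions under a discrete distribution *)

Section expectation.
Context {R : realType} {T : choiceType}.
Implicit Types (mu : distr R T) (f g : T -> \bar R).

Lemma mule_pmf_ge0 mu t (x : \bar R) : 0 <= x -> 0 <= (mu t)%:E * x.
Proof. by move=> x0; rewrite mule_ge0// lee_fin pmf_ge0. Qed.

Lemma expect_ge0 mu f : (forall t, 0 <= f t) -> 0 <= expect mu f.
Proof. by move=> f0; apply: esum_ge0 => t _; exact: mule_pmf_ge0. Qed.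

(** Comparison is asked only on the support of [mu], because [argmax_rule] constrains only indices
    of nonzero probability. *)
Lemma le_expect mu f g : (forall t, mu t != 0%R -> f t <= g t) ->
  expect mu f <= expect mu g.
Proof.
move=> fg; apply: le_esum => t _.
have [->|mut] := eqVneq (mu t) 0%R; first by rewrite !mul0e.
by apply: lee_wpmul2l; [rewrite lee_fin pmf_ge0|exact: fg].
Qed.

Lemma eq_expect mu f g : f =1 g -> expect mu f = expect mu g.
Proof. by move=> fg; apply: eq_esum => t _; rewrite fg. Qed.

Lemma expectD mu f g : (forall t, 0 <= f t) -> (forall t, 0 <= g t) ->
  expect mu (fun t => f t + g t) = expect mu f + expect mu g.
Proof.
move=> f0 g0; rewrite /expect -esumD; first last.
- by move=> t _; exact: mule_pmf_ge0.
- by move=> t _; exact: mule_pmf_ge0.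
by apply: eq_esum => t _; rewrite ge0_muleDr.
Qed.

Lemma expectZl mu (c : R) f : (0 <= c)%R -> (forall t, 0 <= f t) ->
  expect mu (fun t => c%:E * f t) = c%:E * expect mu f.
Proof.
move=> c0 f0; rewrite /expect -esumZl//; last by move=> t; exact: mule_pmf_ge0.
by apply: eq_esum => t _; rewrite muleCA.
Qed.

Lemma expect_cst mu (c : R) : (0 <= c)%R -> expect mu (fun=> c%:E) = c%:E.
Proof.
move=> c0; rewrite -[RHS]mule1 -(pmf_sum1 mu) -esumZl//.
  by apply: eq_esum => t _; rewrite muleC.
by move=> t; rewrite lee_fin pmf_ge0.
Qed.

(** Gives expectations real values, so that the estimates and the difference of two [J] can be
    handled in [R]. *)
Lemma expect_bounded mu (c : R) (f : T -> R) : (forall t, 0 <= f t <= c)%R ->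
  exists2 r : R, (0 <= r <= c)%R & expect mu (fun t => (f t)%:E) = r%:E.
Proof.
move=> fc; have f0 t : 0 <= (f t)%:E by rewrite lee_fin; case/andP: (fc t).
have [c0|c0] := leP 0%R c; last first.
  (* A negative [c] leaves [T] empty, against total mass 1. *)
  have no (t : T) : False by case/andP: (fc t) => /le_trans h /h; rewrite leNgt c0.
  have : expect mu (fun=> 1) = 1 by exact: expect_cst.
  rewrite (_ : expect _ _ = 0); first by move=> /eqP; rewrite eqe eq_sym oner_eq0.
  by rewrite /expect esum1// => t; case: (no t).
have : expect mu (fun t => (f t)%:E) <= c%:E.
  rewrite -(expect_cst mu c0); apply: le_expect => t _.
  by rewrite lee_fin; case/andP: (fc t).
have := expect_ge0 mu f0; case: (expect _ _) => [r||]//.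
by rewrite !lee_fin => r0 rc; exists r => //; rewrite r0.
Qed.

End expectation.

Lemma expect_dunit {R : realType} {T : choiceType} (t : T) (f : T -> \bar R) :
  0 <= f t -> expect (dunit t : distr R T) f = f t.
Proof.
move=> f0; rewrite -[RHS](@esum_set1 R T t f)// [RHS]esum_mkcond.
apply: eq_esum => u _ /=; have [->|ut] := eqVneq u t.
  by rewrite mem_set// mul1e.
by rewrite memNset ?mul0e//; apply/eqP.
Qed.

Lemma expect_dbind {R : realType} {T U : choiceType} (mu : distr R T)
    (k : T -> distr R U) (f : U -> R) : (forall u, 0 <= f u)%R ->
  expect (dbind mu k) (fun u => (f u)%:E) =
  expect mu (fun t => expect (k t) (fun u => (f u)%:E)).
Proof.
move=> f0.
have k0 t u : 0 <= (k t u)%:E * (f u)%:E by rewrite mule_ge0 ?lee_fin ?pmf_ge0.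
transitivity (\esum_(u in [set: U]) \esum_(t in [set: T])
    ((mu t)%:E * ((k t u)%:E * (f u)%:E))).
  apply: eq_esum => u _ /=; rewrite dbind_pmfE.
  rewrite muleC -esumZl//; last by move=> t; rewrite -EFinM lee_fin mulr_ge0 ?pmf_ge0.
  by apply: eq_esum => t _; rewrite muleC muleA.
rewrite esumC; last by move=> u t; rewrite mule_ge0// lee_fin pmf_ge0.
by apply: eq_esum => t _; rewrite esumZl ?pmf_ge0.
Qed.

(** * Expectations over i.i.d. samples *)

Section expect_iid.
Context {R : realType} {T : choiceType} (mu : distr R T).

Lemma expect_diid0 (f : 0.-tuple T -> R) : (0 <= f [tuple])%R ->
  expect (diid mu 0) (fun s => (f s)%:E) = (f [tuple])%:E.
Proof.
move=> f0; rewrite -(expect_cst (diid mu 0) f0); apply: eq_expect => s.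
by rewrite tuple0.
Qed.

(** Reindexing along [cons_tuple] splits the product weight into first draw and rest; this drives
    the inductions on [N]. *)
Lemma expect_diidS N (f : N.+1.-tuple T -> \bar R) : (forall s, 0 <= f s) ->
  expect (diid mu N.+1) f =
  expect mu (fun t => expect (diid mu N) (fun s => f (cons_tuple t s))).
Proof.
move=> f0; rewrite {1}/expect (@reindex_esum R (T * N.-tuple T)%type _ setT setT
  (fun p => cons_tuple p.1 p.2)); last first.
  split; first by [].
  - move=> [a s] [b t] _ _ /= /(congr1 val) /= [-> st].
    by congr pair; apply: val_inj.
  - move=> t _; exists (thead t, [tuple of behead t]) => //=.
    by rewrite [RHS]tuple_eta; apply: val_inj.
transitivity (\esum_(p in [set: T * N.-tuple T])
    (mu p.1)%:E * ((diid mu N p.2)%:E * f (cons_tuple p.1 p.2))).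
  apply: eq_esum => p _; rewrite muleA -EFinM; congr (_%:E * _).
  rewrite /= /diid_pmf big_ord_recl tnth0; congr (_ * _)%R.
  by apply: eq_bigr => i _; rewrite tnthS.
rewrite -(@esum_pair R T (N.-tuple T)
  (fun t s => (mu t)%:E * ((diid mu N s)%:E * f (cons_tuple t s)))); last first.
  by move=> t s; rewrite mule_ge0 ?lee_fin ?pmf_ge0// mule_ge0// lee_fin diid_ge0.
apply: eq_esum => t _; rewrite esumZl ?pmf_ge0// => s.
by rewrite mule_ge0// lee_fin diid_ge0.
Qed.

Lemma expect_diid_sum N (h : T -> R) (v : R) : (forall t, 0 <= h t)%R ->
  expect mu (fun t => (h t)%:E) = v%:E ->
  expect (diid mu N) (fun s => (\sum_(i < N) h (tnth s i))%:E) = (N%:R * v)%:E.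
Proof.
move=> h0 hv; have hE0 t : 0 <= (h t)%:E by rewrite lee_fin.
have v0 : (0 <= v)%R by rewrite -lee_fin -hv expect_ge0.
have S0 n (s : n.-tuple T) : (0 <= \sum_(i < n) h (tnth s i))%R.
  by rewrite sumr_ge0.
elim: N => [|N IHN].
  rewrite (@expect_diid0 (fun s => \sum_(i < 0) h (tnth s i))%R)//.
  by rewrite big_ord0 mul0r.
rewrite expect_diidS; last by move=> s; rewrite lee_fin.
transitivity (expect mu (fun t => (h t)%:E + (N%:R * v)%:E)).
  apply: eq_expect => t; rewrite -IHN -[X in X + _](expect_cst (diid mu N))//.
  rewrite -expectD// => [|s]; last by rewrite lee_fin.
  apply: eq_expect => s; rewrite big_ord_recl tnth0 EFinD; congr (_ + _%:E).
  by apply: eq_bigr => i _; rewrite tnthS.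
have Nv0 : (0 <= N%:R * v)%R by rewrite mulr_ge0.
by rewrite expectD// expect_cst// hv -EFinD -natr1 mulrDl mul1r addrC.
Qed.

End expect_iid.

(* The expected value, given the sample [s], of simulating the comparator by
   rejection sampling: [y] is accepted with probability [a y] and then earns
   [g y]; nothing is earned when the whole sample is rejected. *)
Definition rejection_value {R : realType} {T : Type} (a g : T -> R) (s : seq T) : R :=
  foldr (fun y v => a y * g y + (1 - a y) * v)%R 0%R s.

(** * Value of rejection sampling on an i.i.d. sample *)

Section rejection.
Context {R : realType} {T : choiceType} (mu : distr R T) (a g : T -> R) (K A B : R).
Hypotheses (a01 : forall t, (0 <= a t <= 1)%R) (gK : forall t, (0 <= g t <= K)%R).
Hypotheses (EA : expect mu (fun t => (a t)%:E) = A%:E)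
  (EB : expect mu (fun t => (a t * g t)%:E) = B%:E).

Lemma rejection_value_ge0 s : (0 <= rejection_value a g s)%R.
Proof.
elim: s => //= y s IHs; have /andP[a0 a1] := a01 y; have /andP[g0 _] := gK y.
by rewrite addr_ge0// mulr_ge0// subr_ge0.
Qed.

(** Each stage is a convex combination of [g y] and the value of the rest; [0 <= m] covers the empty
    sample, worth 0. *)
Lemma rejection_value_le s (m : R) : (0 <= m)%R ->
  (forall y, y \in s -> g y <= m)%R -> (rejection_value a g s <= m)%R.
Proof.
move=> m0; elim: s => //= y s IHs gm; have /andP[a0 a1] := a01 y.
have gy : (g y <= m)%R by rewrite gm ?mem_head.
have vs : (rejection_value a g s <= m)%R.
  by apply: IHs => z zs; rewrite gm// in_cons zs orbT.
have /(ler_wpM2l a0) : (g y <= m)%R by [].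
have /(ler_wpM2l (_ : 0 <= 1 - a y)%R) := vs; rewrite subr_ge0 => /(_ a1).
lra.
Qed.

(** Conditioning on the first draw gives the recursion [w' = B + (1 - A) * w], a geometric sum. The
    closed form is multiplied by [A] to avoid dividing by a possibly null acceptance probability. *)
Lemma expect_rejection_value N : exists2 w : R,
  expect (diid mu N) (fun s => (rejection_value a g s)%:E) = w%:E &
  (A * w = B * (1 - (1 - A) ^+ N))%R.
Proof.
have a0 t : (0 <= a t)%R by case/andP: (a01 t).
have a1 t : (0 <= 1 - a t)%R by rewrite subr_ge0; case/andP: (a01 t).
have E1 : expect mu (fun t => (1 - a t)%:E) = (1 - A)%:E.
  have [t|r _ E] := @expect_bounded _ _ mu 1%R (fun t => 1 - a t)%R.
    by rewrite a1 gerBl a0.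
  have : expect mu (fun t => (a t)%:E + (1 - a t)%:E) = 1.
    rewrite -(expect_cst mu ler01); apply: eq_expect => t.
    by rewrite -EFinD addrC subrK.
  rewrite expectD; [|by move=> t; rewrite lee_fin..].
  by rewrite EA E -EFinD => -[<-]; rewrite addrC addKr.
elim: N => [|N [w Ew Aw]].
  exists 0%R; last by rewrite expr0; ring.
  by rewrite (@expect_diid0 _ _ _ (fun s => rejection_value a g s)).
have w0 : (0 <= w)%R.
  by rewrite -lee_fin -Ew expect_ge0// => s; rewrite lee_fin rejection_value_ge0.
exists (B + (1 - A) * w)%R; last first.
  by rewrite mulrDr mulrCA Aw exprS; ring.
have ag0 t : (0 <= a t * g t)%R.
  by rewrite mulr_ge0//; case/andP: (gK t).
rewrite expect_diidS; last by move=> s; rewrite lee_fin rejection_value_ge0.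
transitivity (expect mu (fun t => (a t * g t)%:E + w%:E * (1 - a t)%:E)).
  apply: eq_expect => t; rewrite muleC -Ew -expectZl//; last first.
    by move=> s; rewrite lee_fin rejection_value_ge0.
  rewrite -[X in X + _](expect_cst (diid mu N))// -expectD//.
    by move=> s; rewrite lee_fin.
  by move=> s; rewrite -EFinM lee_fin mulr_ge0 ?rejection_value_ge0.
rewrite expectD; last 2 first.
- by move=> t; rewrite lee_fin.
- by move=> t; rewrite lee_fin mulr_ge0.
by rewrite expectZl// EB E1 -EFinM -EFinD mulrC.
Qed.

End rejection.

(** * Comparing [q] with [p] through the coverage [chi] *)

Section change_of_measure.
Context {R : realType} {T : choiceType} (p q : distr R T) (chi : R).
Hypotheses (pq0 : forall t, p t = 0%R -> q t = 0%R)
  (Echi : expect q (fun t => (q t / p t)%:E) = chi%:E).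

(* AM-GM with weight [m] stands in for the Cauchy-Schwarz inequality. *)
Lemma change_of_measure_sqr (f g : T -> R) (e m : R) : (0 < m)%R ->
  (forall t, 0 <= f t)%R -> (forall t, 0 <= g t)%R ->
  expect p (fun t => ((g t - f t) ^+ 2)%:E) = e%:E ->
  expect q (fun t => (f t)%:E) <=
  expect q (fun t => (g t)%:E) + (m / 2 * chi + (2 * m)^-1 * e)%:E.
Proof.
move=> m0 f0 g0 Ee; have m20 : (0 <= (2 * m)^-1)%R by rewrite invr_ge0 mulr_ge0// ltW.
have m2 : (0 <= m / 2)%R by rewrite divr_ge0// ltW.
have w0 t : (0 <= q t / p t)%R by rewrite divr_ge0 ?pmf_ge0.
have d0 t : (0 <= (g t - f t) ^+ 2)%R by rewrite sqr_ge0.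
rewrite EFinD (EFinM _ chi) (EFinM _ e) -Echi -Ee -expectZl// -expectZl//.
rewrite addeA -expectD//; last first.
  by move=> t; rewrite mule_ge0 ?lee_fin.
rewrite /expect -esumD; last 2 first.
- move=> t _; apply: mule_pmf_ge0.
  by rewrite adde_ge0 ?mule_ge0 ?lee_fin.
- by move=> t _; apply: mule_pmf_ge0; rewrite mule_ge0 ?lee_fin.
apply: le_esum => t _; rewrite lee_fin /=.
have [pt|pt] := eqVneq (p t) 0%R; first by rewrite pt pq0// !mul0r addr0.
have -> : q t = (q t / p t * p t)%R by rewrite divfK.
rewrite mulfK//; set w := (q t / p t)%R.
have pt0 : (0 <= p t)%R by exact: pmf_ge0.
rewrite -subr_ge0.
(* With [w] the density of [q] with respect to [p], the gap is [p t] times [w * (g - f) + m * w^2 /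
   2 + (g - f)^2 / (2 * m)], a perfect square. *)
rewrite [X in (0 <= X)%R](_ : _ = p t * ((2 * m)^-1 * (m * w + g t - f t) ^+ 2))%R.
  by rewrite mulr_ge0// mulr_ge0// sqr_ge0.
by field; rewrite gt_eqF.
Qed.

(* [accept M t] approximates [q t / (M * p t)], up to capping at [1]. *)
Definition accept (M : R) (t : T) : R := (q t / (q t + M * p t))%R.

Lemma accept_bounds M t : (0 < M)%R -> (0 <= accept M t <= 1)%R.
Proof.
move=> M0; have q0 := pmf_ge0 q t.
have Mp : (0 <= M * p t)%R by rewrite mulr_ge0 ?pmf_ge0// ltW.
rewrite /accept divr_ge0 ?addr_ge0//=.
(* Where [p] and [q] both vanish, the convention [0^-1 = 0] makes [accept] null. *)
have [->|nz] := eqVneq (q t + M * p t)%R 0%R; first by rewrite invr0 mulr0.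
by rewrite ler_pdivrMr ?mul1r ?lerDl// lt_neqAle eq_sym nz addr_ge0.
Qed.

(** Where [p] is positive, [q - M * p * accept M = q^2 / (q + M * p) <= q^2 / (M * p)], and the last
    term sums to [chi / M]; the factor [g <= K] gives the bias. *)
Lemma expect_le_accept (M K B : R) (g : T -> R) : (0 < M)%R -> (0 <= K)%R ->
  (forall t, 0 <= g t <= K)%R ->
  expect p (fun t => (accept M t * g t)%:E) = B%:E ->
  expect q (fun t => (g t)%:E) <= (M * B + K / M * chi)%:E.
Proof.
move=> M0 K0 gK EB; have M_ge0 := ltW M0.
have a0 t : (0 <= accept M t)%R by case/andP: (accept_bounds t M0).
have g0 t : (0 <= g t)%R by case/andP: (gK t).
have w0 t : (0 <= q t / p t)%R by rewrite divr_ge0 ?pmf_ge0.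
have ag0 t : (0 <= accept M t * g t)%R by rewrite mulr_ge0.
have KM : (0 <= K / M)%R by rewrite divr_ge0// ltW.
rewrite EFinD (EFinM _ chi) (EFinM _ B) -Echi -EB -expectZl// -expectZl//.
rewrite /expect -esumD; last 2 first.
- by move=> t _; apply: mule_pmf_ge0; rewrite mule_ge0 ?lee_fin.
- by move=> t _; apply: mule_pmf_ge0; rewrite mule_ge0 ?lee_fin.
apply: le_esum => t _; rewrite lee_fin /=.
have [pt|pt] := eqVneq (p t) 0%R; first by rewrite pt pq0// !mul0r addr0.
have pt0 : (0 < p t)%R by rewrite lt_neqAle eq_sym pt pmf_ge0.
have q0 := pmf_ge0 q t; have Mp : (0 < M * p t)%R by rewrite mulr_gt0.
have D0 : (0 < q t + M * p t)%R by rewrite ltr_wpDl.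
have gt0 := g0 t; have /andP[_ gtK] := gK t.
rewrite -subr_ge0 [X in (0 <= X)%R](_ : _ =
  q t * q t / (M * p t) * (K - g t * (M * p t) / (q t + M * p t)))%R.
  apply: mulr_ge0; first by rewrite divr_ge0 ?mulr_ge0// ltW.
  rewrite subr_ge0 ler_pdivrMr//; apply: (@le_trans _ _ (K * (M * p t)))%R.
    by rewrite ler_wpM2r// ltW.
  by rewrite ler_wpM2l// lerDr.
by rewrite /accept; field; rewrite !gt_eqF.
Qed.

(** Pointwise [M * p * accept M <= q], and [q] has mass 1. *)
Lemma expect_accept_le M A : (0 < M)%R ->
  expect p (fun t => (accept M t)%:E) = A%:E -> (M * A <= 1)%R.
Proof.
move=> M0 EA; have a0 t : (0 <= accept M t)%R by case/andP: (accept_bounds t M0).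
rewrite -lee_fin EFinM -EA -expectZl//; last exact: ltW.
rewrite -(pmf_sum1 q) /expect.
apply: le_esum => t _; rewrite lee_fin /accept /=.
have q0 := pmf_ge0 q t.
have Mp : (0 <= M * p t)%R by rewrite mulr_ge0 ?pmf_ge0// ltW.
have [->|nz] := eqVneq (q t + M * p t)%R 0%R; first by rewrite invr0 !mulr0.
have D0 : (0 < q t + M * p t)%R by rewrite lt_neqAle eq_sym nz addr_ge0.
rewrite [X in (X <= _)%R](_ : _ = q t * (M * p t) / (q t + M * p t))%R; last first.
  by field.
by rewrite ler_pdivrMr// ler_wpM2l// lerDr.
Qed.

End change_of_measure.

(** * Two bounds on Best-of-N expectations, valid for randomized tie-breaking *)

Section best_of_N.
Context {R : realType} {X : Type} {Y : choiceType}.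
Variables (pi_ref : policy R X Y) (N : nat) (tie : X -> N.-tuple Y -> distr R 'I_N) (x : X).

Lemma expect_BoN (f : Y -> R) : (forall y, 0 <= f y)%R ->
  expect (BoN pi_ref tie x) (fun y => (f y)%:E) =
  expect (diid (pi_ref x) N) (fun ys => expect (tie x ys) (fun i => (f (tnth ys i))%:E)).
Proof.
move=> f0; rewrite /BoN expect_dbind//; apply: eq_expect => ys.
by rewrite expect_dbind//; apply: eq_expect => i;
  rewrite (@expect_dunit _ _ _ (fun y => (f y)%:E)) ?lee_fin.
Qed.

(** The returned response is one of the samples, so [h] there is at most its sum over the sample.
    This encodes the density bound [N]. *)
Lemma expect_BoN_le (h : Y -> R) (v : R) : (forall y, 0 <= h y)%R ->
  expect (pi_ref x) (fun y => (h y)%:E) = v%:E ->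
  expect (BoN pi_ref tie x) (fun y => (h y)%:E) <= (N%:R * v)%:E.
Proof.
move=> h0 hv; rewrite expect_BoN// -(expect_diid_sum N h0 hv).
apply: le_expect => ys _.
have S0 : (0 <= \sum_(i < N) h (tnth ys i))%R by rewrite sumr_ge0.
rewrite -(expect_cst (tie x ys) S0); apply: le_expect => i _.
by rewrite lee_fin (bigD1 i)//= lerDl sumr_ge0.
Qed.

(** Both procedures are compared sample by sample: a returned index maximizes [rhat x] over the
    sample, hence dominates the rejection value. *)
Lemma expect_BoN_ge_rejection (rhat : X -> Y -> R) (a : Y -> R) (K : R) :
  argmax_rule rhat tie -> (forall y, 0 <= a y <= 1)%R ->
  (forall y, 0 <= rhat x y <= K)%R ->
  expect (diid (pi_ref x) N) (fun ys => (rejection_value a (rhat x) ys)%:E) <=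
  expect (BoN pi_ref tie x) (fun y => (rhat x y)%:E).
Proof.
move=> tieP a01 gK; have g0 y : (0 <= rhat x y)%R by case/andP: (gK y).
rewrite expect_BoN//; apply: le_expect => ys _.
have v0 := rejection_value_ge0 a01 gK ys.
rewrite -(expect_cst (tie x ys) v0); apply: le_expect => i ti.
rewrite lee_fin; apply: (rejection_value_le a01) => // y /tnthP[j ->].
exact: tieP ti j.
Qed.

End best_of_N.

(** * Regret bounds at a fixed prompt *)

Section regret.
Context {R : realType} {X : Type} {Y : choiceType}.
Variables (Rmax : R) (pi_ref : policy R X Y) (rstar rhat : X -> Y -> R).
Variables (N : nat) (tie : X -> N.-tuple Y -> distr R 'I_N) (x : X) (pi_star : policy R X Y).
Hypotheses (Rmax_ge1 : (1 <= Rmax)%R) (rstarP : forall x y, (0 <= rstar x y <= Rmax)%R)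
  (rhatP : forall x y, (0 <= rhat x y <= Rmax)%R) (N_gt0 : (0 < N)%N)
  (tieP : argmax_rule rhat tie).
Local Notation eps2 := (eps_RM2 pi_ref rstar rhat x).
Local Notation eps := (eps_RM pi_ref rstar rhat x).
Local Notation L := (ln (Rmax / eps)%R).
Hypothesis eps2P : (0 < eps2 <= 1)%R.

(** The integrand is at most [Rmax ^+ 2], so [fine] acts on a finite value. *)
Lemma eps_RM2E :
  expect (pi_ref x) (fun y => ((rhat x y - rstar x y) ^+ 2)%:E) = eps2%:E.
Proof.
rewrite /eps_RM2.
have [y|r _ ->//] := @expect_bounded _ _ (pi_ref x) (Rmax ^+ 2)%R
  (fun y => (rhat x y - rstar x y) ^+ 2)%R.
have /andP[? ?] := rstarP x y; have /andP[? ?] := rhatP x y.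
by rewrite sqr_ge0/=; nra.
Qed.

Lemma eps_gt0 : (0 < eps)%R.
Proof. by rewrite sqrtr_gt0; case/andP: eps2P. Qed.

Lemma eps_sqr : (eps ^+ 2 = eps2)%R.
Proof. by rewrite sqr_sqrtr// ltW//; case/andP: eps2P. Qed.

Lemma eps_le1 : (eps <= 1)%R.
Proof. by rewrite -sqrtr1 ler_wsqrtr//; case/andP: eps2P. Qed.

Lemma log_ratio_ge0 : (0 <= L)%R.
Proof.
rewrite ln_ge0// ler_pdivlMr ?eps_gt0// mul1r.
exact: le_trans eps_le1 Rmax_ge1.
Qed.

Lemma regret_le_Rmax : J rstar pi_star x - J rstar (BoN pi_ref tie) x <= Rmax%:E.
Proof.
have [js /andP[_ jsR] Ejs] := expect_bounded (pi_star x) (rstarP x).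
have [jb /andP[jb0 _] Ejb] := expect_bounded (BoN pi_ref tie x) (rstarP x).
by rewrite /J Ejs Ejb -EFinB lee_fin; lra.
Qed.

(** The main regime, with finite coverage. The bound [4^-1 <= L] turns [4 * C * L <= N] into
    [C <= N], used for the comparator's change of measure. *)
Lemma BoN_regret (C : R) : coverage pi_ref pi_star x = C%:E ->
  (4^-1 <= L)%R -> (4 * C * L <= N%:R)%R ->
  J rstar pi_star x - J rstar (BoN pi_ref tie) x <=
  (2 * (Rmax * (C * L / N%:R)) + 3 * Num.sqrt (N%:R * eps2))%:E.
Proof.
rewrite /coverage; case: ifPn => // /asboolP pq0 Echi L4 HN.
have C0 : (0 <= C)%R.
  by rewrite -lee_fin -Echi expect_ge0// => y; rewrite lee_fin divr_ge0 ?pmf_ge0.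
have L0 : (0 < L)%R by lra.
have N0 : (0 < N%:R :> R)%R by rewrite ltr0n.
have R0 : (0 < Rmax)%R by exact: lt_le_trans Rmax_ge1.
pose s : R := Num.sqrt N%:R.
have s2 : (s ^+ 2 = N%:R)%R by rewrite sqr_sqrtr// ltW.
have s0 : (0 < s)%R by rewrite sqrtr_gt0.
have s1 : (1 <= s)%R by rewrite -sqrtr1 ler_wsqrtr// ler1n.
have e0 := eps_gt0.
have sqrtE : (Num.sqrt (N%:R * eps2) = s * eps)%R by rewrite sqrtrM// ltW.
rewrite sqrtE.
pose M := (N%:R / (2 * L))%R.
have M0 : (0 < M)%R by rewrite divr_gt0// mulr_gt0.
(* [C / M = 2 * C * L / N]; this is where the factor 4 in the condition on [N] comes from. *)
have CM : (C / M <= 2^-1)%R.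
  rewrite ler_pdivrMr// /M mulrA ler_pdivlMr ?mulr_gt0//; lra.
have a01 y := accept_bounds (pi_ref x) (pi_star x) y M0.
set a := accept (pi_ref x) (pi_star x) M in a01.
have [A /andP[A0 A1] EA] := expect_bounded (pi_ref x) a01.
have [|B /andP[B0 _] EB] := @expect_bounded _ _ (pi_ref x) Rmax (fun y => a y * rhat x y)%R.
  move=> y; have /andP[? ?] := a01 y; have /andP[? ?] := rhatP x y.
  by rewrite mulr_ge0//= -[X in (_ <= X)%R]mul1r ler_pM.
have [js _ Ejs] := expect_bounded (pi_star x) (rstarP x).
have [gs _ Egs] := expect_bounded (pi_star x) (rhatP x).
have [jb _ Ejb] := expect_bounded (BoN pi_ref tie x) (rstarP x).
have [gb _ Egb] := expect_bounded (BoN pi_ref tie x) (rhatP x).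
have rs0 y : (0 <= rstar x y)%R by case/andP: (rstarP x y).
have rh0 y : (0 <= rhat x y)%R by case/andP: (rhatP x y).
have MA1 : (M * A <= 1)%R by exact: expect_accept_le EA.
(* The accept bound at the constant function 1 reads [1 <= M * A + C / M]. *)
have MA2 : (2^-1 <= M * A)%R.
  have EA1 : expect (pi_ref x) (fun y => (a y * 1)%:E) = A%:E.
    by rewrite -EA; apply: eq_expect => y; rewrite mulr1.
  have h01 (y : Y) : (0 <= (1 : R) <= 1)%R by rewrite ler01 lexx.
  have := expect_le_accept pq0 Echi M0 ler01 h01 EA1.
  rewrite expect_cst// lee_fin {h01} => h.
  by move: h CM; rewrite mulrAC mul1r; lra.
have BA : (B <= Rmax * A)%R.
  have a0 y : (0 <= a y)%R by case/andP: (a01 y).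
  rewrite -lee_fin -EB EFinM -EA -expectZl//; last exact: ltW.
  apply: le_expect => y _; rewrite -EFinM lee_fin mulrC.
  by apply: ler_wpM2r => //; case/andP: (rhatP x y).
have [w Ew Aw] := expect_rejection_value a01 (rhatP x) EA EB N.
have wgb : (w <= gb)%R.
  by rewrite -lee_fin -Ew -Egb; apply: expect_BoN_ge_rejection (rhatP x).
have gsB : (gs <= M * B + Rmax / M * C)%R.
  by rewrite -lee_fin -Egs; apply: expect_le_accept EB => //; exact: ltW.
(* With AM-GM weight [eps / s], both error terms are at most [s * eps / 2]: see [E3], and [E4],
   which uses [C <= N]. *)
have me0 : (0 < eps / s)%R by rewrite divr_gt0.
have jsgs : (js <= gs + (eps / s / 2 * C + (2 * (eps / s))^-1 * eps2))%R.
  rewrite -lee_fin -Ejs EFinD -Egs.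
  exact: (change_of_measure_sqr pq0 Echi me0 rs0 rh0 eps_RM2E).
(* AM-GM with weight [s * eps]: the squared error under Best-of-N is at most [N * eps2], so the two
   terms equal [s * eps / 2]. *)
have gbjb : (gb <= jb + (2 * (s * eps))^-1 * (N%:R * eps2) + s * eps / 2)%R.
  have se0 : (0 < s * eps)%R by rewrite mulr_gt0.
  have c0 : (0 <= (2 * (s * eps))^-1)%R by rewrite invr_ge0 mulr_ge0// ltW.
  have d0 y : (0 <= (rhat x y - rstar x y) ^+ 2)%R by rewrite sqr_ge0.
  have h0 : (0 <= s * eps / 2)%R by rewrite divr_ge0// ltW.
  rewrite -lee_fin -Egb; apply: (@le_trans _ _ (expect (BoN pi_ref tie x)
    (fun y => (rstar x y)%:E + ((2 * (s * eps))^-1%:E *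
      ((rhat x y - rstar x y) ^+ 2)%:E) + (s * eps / 2)%:E))).
    apply: le_expect => y _; rewrite lee_fin /= -subr_ge0.
    rewrite [X in (0 <= X)%R](_ : _ = (2 * (s * eps))^-1 *
      (rhat x y - rstar x y - s * eps) ^+ 2)%R; first by rewrite mulr_ge0// sqr_ge0.
    by field; rewrite !gt_eqF.
  rewrite expectD//; last first.
    by move=> y; rewrite adde_ge0 ?mule_ge0 ?lee_fin.
  rewrite expectD//; last by move=> y; rewrite mule_ge0 ?lee_fin.
  rewrite expect_cst// expectZl// Ejb !EFinD leeD2r// leeD2l//.
  rewrite EFinM lee_wpmul2l ?lee_fin//.
  exact: (expect_BoN_le tie d0 eps_RM2E).
(* [(1 - A) ^+ N <= expR (- A * N)], and [A * N >= N / (2 * M) = L] by [MA2]. *)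
have tail : ((1 - A) ^+ N <= eps / Rmax)%R.
  have -> : (eps / Rmax = expR (- L))%R.
    by rewrite expRN lnK ?invf_div// posrE divr_gt0.
  apply: (@le_trans _ _ (expR (- A) ^+ N)%R).
    by rewrite lerXn2r ?nnegrE ?expR_ge0 ?subr_ge0// expR_ge1Dx.
  rewrite -expRM_natr ler_expR mulNr lerN2.
  have -> : (L = 2^-1 * (N%:R / M))%R by rewrite /M; field; rewrite !gt_eqF.
  rewrite mulrA ler_pdivrMr// mulrAC ler_pM2r//; lra.
(* After multiplying by [A]: [A * M * B <= B = A * w + B * (1 - A) ^+ N], and [B <= Rmax * A]. *)
have Bw : (M * B <= w + Rmax * (1 - A) ^+ N)%R.
  have A_gt0 : (0 < A)%R.
    by rewrite -(pmulr_rgt0 _ M0); apply: lt_le_trans MA2; rewrite invr_gt0.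
  rewrite -(ler_pM2l A_gt0) mulrDr Aw.
  have t0 : (0 <= (1 - A) ^+ N)%R by rewrite exprn_ge0// subr_ge0.
  have := ler_wpM2r t0 BA; have := ler_wpM2r B0 MA1; lra.
have Rtail : (Rmax * (1 - A) ^+ N <= eps)%R.
  by rewrite mulrC -ler_pdivlMr.
have E1 : (Rmax / M * C = 2 * (Rmax * (C * L / N%:R)))%R.
  by rewrite /M; field; rewrite !gt_eqF.
have E2 : ((2 * (s * eps))^-1 * (N%:R * eps2) = s * eps / 2)%R.
  by rewrite -eps_sqr -s2; field; rewrite !gt_eqF.
have E3 : ((2 * (eps / s))^-1 * eps2 = s * eps / 2)%R.
  by rewrite -eps_sqr; field; rewrite !gt_eqF.
have E4 : (eps / s / 2 * C <= s * eps / 2)%R.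
  have CN : (C <= s ^+ 2)%R.
    rewrite s2; apply: le_trans HN; rewrite mulrAC ler_peMl//; lra.
  have -> : (s * eps / 2 = eps / s / 2 * s ^+ 2)%R by field; rewrite !gt_eqF.
  by rewrite ler_wpM2l// divr_ge0// ltW.
have E5 : (eps <= s * eps)%R by rewrite ler_peMl// ltW.
(* The three copies of [s * eps] come from the comparator's reward error, that of Best-of-N, and
   total rejection ([Rtail], [E5]); [E1] is the bias. *)
rewrite /J Ejs Ejb -EFinB lee_fin; lra.
Qed.

(* If [Rmax] and [eps] are comparable, the bound already exceeds [Rmax]. *)
Lemma Rmax_le_eps : (L < 4^-1)%R -> (Rmax <= 3 * eps)%R.
Proof.
move=> L4; have e0 := eps_gt0; have R0 : (0 < Rmax)%R by exact: lt_le_trans Rmax_ge1.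
have eE : (eps / Rmax = expR (- L))%R.
  by rewrite expRN lnK ?invf_div// posrE divr_gt0.
(* [expR (- L) >= 1 - L > 3/4]; the weaker 1/3 suffices for the constant 3 of the final bound. *)
have : (3^-1 <= eps / Rmax)%R.
  by rewrite eE; apply: le_trans (expR_ge1Dx _); lra.
by rewrite ler_pdivlMr// => h; lra.
Qed.

Lemma coverage_ge0 : 0 <= coverage pi_ref pi_star x.
Proof.
rewrite /coverage; case: ifP => // _; apply: expect_ge0 => y.
by rewrite lee_fin divr_ge0 ?pmf_ge0.
Qed.

Lemma BoN_regret_le :
  4%:E * coverage pi_ref pi_star x * L%:E <= N%:R%:E ->
  J rstar pi_star x - J rstar (BoN pi_ref tie) x <=
  3%:E * (Rmax%:E * (coverage pi_ref pi_star x * L%:E / N%:R%:E)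
          + (Num.sqrt (N%:R * eps2))%:E).
Proof.
have N0 : (0 < N%:R :> R)%R by rewrite ltr0n.
have L0 := log_ratio_ge0; have R0 : (0 < Rmax)%R by exact: lt_le_trans Rmax_ge1.
have eN : (eps <= Num.sqrt (N%:R * eps2))%R.
  rewrite ler_wsqrtr// ler_peMl ?ler1n//; last by rewrite ltW//; case/andP: eps2P.
have Nv : (N%:R%:E)^-1 = (N%:R^-1)%:E :> \bar R by rewrite inver gt_eqF.
rewrite Nv; have Ni : (0 <= N%:R^-1 :> R)%R by rewrite invr_ge0 ltW.
have [L4 HN|L4] := ltP L (4^-1)%R.
  apply: (le_trans regret_le_Rmax).
  apply: (@le_trans _ _ (3%:E * (Num.sqrt (N%:R * eps2))%:E)).
    rewrite -EFinM lee_fin; have := Rmax_le_eps L4; lra.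
  rewrite lee_wpmul2l ?lee_fin// leeDr// !mule_ge0 ?lee_fin ?coverage_ge0//.
  exact: ltW.
case E : (coverage _ _ _) coverage_ge0 => [C||]//.
  move=> C0 HN; have {}HN : (4 * C * L <= N%:R)%R by rewrite -lee_fin.
  apply: (le_trans (BoN_regret E L4 HN)).
  rewrite -[leRHS]/((3 * (Rmax * (C * L / N%:R) + Num.sqrt (N%:R * eps2)))%R%:E) lee_fin.
  have : (0 <= Rmax * (C * L / N%:R))%R by rewrite !mulr_ge0// ltW.
  lra.
(* Infinite coverage with [L > 0] makes the condition on [N] fail. *)
have LE : 0 < L%:E by rewrite lte_fin; lra.
by rewrite gt0_muley ?lte_fin// gt0_mulye// leye_eq.
Qed.

(** With [z] the cube root of [Rmax * C * L / eps], the scale [T] is [z ^+ 2] and the target rate is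
    [z * eps]. Both terms of the general bound are then multiples of [z * eps]. *)
Lemma BoN_regret_optimal_N (C1 C2 : R) :
  let C := coverage pi_ref pi_star x in
  let T := (Rmax%:E * C * L%:E / eps%:E) `^ (2 / 3) in
  (4 <= C1)%R -> C1%:E * T <= N%:R%:E -> N%:R%:E <= C2%:E * T ->
  J rstar pi_star x - J rstar (BoN pi_ref tie) x <=
  (3 * (C1^-1 + Num.sqrt C2) + 1)%:E * (Rmax%:E * C * eps2%:E * L%:E) `^ (1 / 3).
Proof.
move=> C T C14; rewrite {}/T.
have N0 : (0 < N%:R :> R)%R by rewrite ltr0n.
have e0 := eps_gt0; have R0 : (0 < Rmax)%R by exact: lt_le_trans Rmax_ge1.
have C10 : (0 < C1)%R by exact: lt_le_trans C14.
have ev : (eps%:E)^-1 = (eps^-1)%:E :> \bar R by rewrite inver gt_eqF.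
have p23 : (2 / 3 != 0 :> R)%R by rewrite mulf_neq0 ?invr_eq0.
rewrite ev.
(* [L = 0] gives [T = 0], so the upper bound on [N] contradicts [0 < N]; likewise for null coverage
   below. *)
have [L0|L0] := eqVneq L 0%R.
  by rewrite L0 mule0 mul0e poweR0r// !mule0 => _; rewrite lee_fin leNgt N0.
have {}L0 : (0 < L)%R by rewrite lt_neqAle eq_sym L0 log_ratio_ge0.
move: coverage_ge0 BoN_regret_le; rewrite -/C; clearbody C.
case: C => [c||]//; last first.
  (* Infinite coverage gives [T = +oo], so [C1 * T <= N] fails. *)
  move=> _ _; rewrite gt0_muley ?lte_fin// gt0_mulye ?lte_fin//.
  rewrite gt0_mulye ?lte_fin ?invr_gt0// poweRyr// gt0_muley ?lte_fin//.
rewrite lee_fin => c0.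
have [->|cN0] := eqVneq c 0%R.
  by move=> _; rewrite mule0 !mul0e poweR0r// !mule0 => _; rewrite lee_fin leNgt N0.
have {cN0}c0 : (0 < c)%R by rewrite lt_neqAle eq_sym cN0.
move=> small.
pose u := (Rmax * c * L / eps)%R.
(* Extended-real products of finite values reduce by computation, so the real form is reached by
   conversion. *)
rewrite -[X in X `^ (2 / 3)]/(u%:E) -[X in X `^ (1 / 3)]/((Rmax * c * eps2 * L)%:E).
rewrite !poweR_EFin -[X in X -> _ -> _]/(is_true ((C1 * (u `^ (2 / 3)))%:E <= N%:R%:E)).
rewrite -[X in _ -> X -> _]/(is_true (N%:R%:E <= (C2 * (u `^ (2 / 3)))%:E)) !lee_fin.
have u0 : (0 < u)%R by rewrite divr_gt0// !mulr_gt0.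
pose z : R := (u `^ 3^-1)%R.
have z0 : (0 < z)%R by rewrite powR_gt0.
have z3 : (z ^+ 3 = u)%R.
  by rewrite -powR_mulrn ?ltW// -powRrM mulVf// powRr1// ltW.
have z2 : (u `^ (2 / 3) = z ^+ 2)%R.
  by rewrite -powR_mulrn ?ltW// -powRrM mulrC.
have RcL : (Rmax * c * L = z ^+ 3 * eps)%R by rewrite z3 /u divfK ?gt_eqF.
have -> : ((Rmax * c * eps2 * L) `^ (1 / 3) = z * eps)%R.
  rewrite (_ : Rmax * c * eps2 * L = (z * eps) ^+ 3)%R; last first.
    by rewrite mulrAC RcL -eps_sqr; ring.
  have ze0 : (0 <= z * eps)%R by rewrite mulr_ge0// ltW.
  by rewrite -powR_mulrn// -powRrM mul1r mulfV// powRr1.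
rewrite z2 => lowN uppN.
have z2N : (4 * z ^+ 2 <= N%:R)%R.
  by apply: le_trans lowN; rewrite ler_wpM2r// sqr_ge0.
have C20 : (0 <= C2)%R.
  have : (0 < C2 * z ^+ 2)%R by exact: lt_le_trans uppN.
  by rewrite pmulr_lgt0 ?exprn_gt0// => /ltW.
have C1i : (0 <= C1^-1)%R by rewrite invr_ge0 ltW.
have sC2 : (0 <= Num.sqrt C2)%R by exact: sqrtr_ge0.
have ze0 : (0 < z * eps)%R by rewrite mulr_gt0.
have k0 : (0 <= 3 * (C1^-1 + Num.sqrt C2))%R by rewrite mulr_ge0// addr_ge0.
(* If the rate exceeds [Rmax], the trivial bound suffices; this accounts for the [+ 1] in the
   constant. *)
have [big|zle] := ltP Rmax (z * eps)%R.
  apply: (le_trans regret_le_Rmax); rewrite lee_fin; apply: (le_trans (ltW big)).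
  by rewrite ler_peMl ?(ltW ze0)// lerDr.
apply: le_trans (small _) _.
  rewrite -[leLHS]/((4 * c * L)%R%:E) lee_fin; apply: le_trans z2N.
  (* [Rmax * c * L = (z * eps) * z ^+ 2 <= Rmax * z ^+ 2], so [4 * z ^+ 2 <= N] implies the
     condition of the general bound. *)
  rewrite -mulrA ler_pM2l// -(ler_pM2l R0) mulrA RcL.
  rewrite (_ : z ^+ 3 * eps = z * eps * z ^+ 2)%R; last by ring.
  by rewrite ler_wpM2r// sqr_ge0.
rewrite inver gt_eqF//.
rewrite -[leLHS]/((3 * (Rmax * (c * L / N%:R) + Num.sqrt (N%:R * eps2)))%R%:E) lee_fin.
have t1 : (Rmax * (c * L / N%:R) <= C1^-1 * (z * eps))%R.
  rewrite !mulrA RcL ler_pdivrMr//.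
  rewrite (_ : z ^+ 3 * eps = C1^-1 * (z * eps) * (C1 * z ^+ 2))%R; last first.
    by field; rewrite gt_eqF.
  by rewrite -(mulrA _ z) ler_wpM2l// mulr_ge0// ltW.
have t2 : (Num.sqrt (N%:R * eps2) <= Num.sqrt C2 * (z * eps))%R.
  have -> : (z * eps = Num.sqrt ((z * eps) ^+ 2))%R by rewrite sqrtr_sqr gtr0_norm.
  rewrite -sqrtrM// ler_wsqrtr// -eps_sqr.
  rewrite (_ : C2 * (z * eps) ^+ 2 = C2 * z ^+ 2 * eps ^+ 2)%R; last by ring.
  by rewrite ler_wpM2r// sqr_ge0.
rewrite mulrDl mul1r -mulrA mulrDl; lra.
Qed.

End regret.

(* For a fixed prompt [x], [eps2] below is the squared reward-model error,
   [eps] the error itself, [C] the coverage coefficient of the comparator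
   (possibly [+oo]) and [L] the logarithmic factor.  *)
Theorem theorem3p1 (R : realType) :
  (exists c c' : R, [/\ (0 < c)%R, (0 < c')%R &
    forall (X : Type) (Y : choiceType) (Rmax : R) (pi_ref : policy R X Y)
      (rstar rhat : X -> Y -> R) (N : nat) (tie : X -> N.-tuple Y -> distr R 'I_N)
      (x : X) (pi_star : policy R X Y),
      (1 <= Rmax)%R ->
      (forall x y, 0 <= rstar x y <= Rmax)%R ->
      (forall x y, 0 <= rhat x y <= Rmax)%R ->
      (0 < N)%N ->
      argmax_rule rhat tie ->
      let eps2 := eps_RM2 pi_ref rstar rhat x in
      let eps := eps_RM pi_ref rstar rhat x in
      let C := coverage pi_ref pi_star x in
      let L := ln (Rmax / eps)%R in
      (0 < eps2 <= 1)%R ->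
      c%:E * C * L%:E <= N%:R%:E ->
      J rstar pi_star x - J rstar (BoN pi_ref tie) x
        <= c'%:E * (Rmax%:E * (C * L%:E / N%:R%:E)
                    + (Num.sqrt (N%:R * eps2))%:E)]) /\
  (exists C0 : R, (0 < C0)%R /\
    forall C1 C2 : R, (C0 <= C1)%R -> (C1 <= C2)%R ->
    exists c'' : R, (0 < c'')%R /\
    forall (X : Type) (Y : choiceType) (Rmax : R) (pi_ref : policy R X Y)
      (rstar rhat : X -> Y -> R) (N : nat) (tie : X -> N.-tuple Y -> distr R 'I_N)
      (x : X) (pi_star : policy R X Y),
      (1 <= Rmax)%R ->
      (forall x y, 0 <= rstar x y <= Rmax)%R ->
      (forall x y, 0 <= rhat x y <= Rmax)%R ->
      (0 < N)%N ->
      argmax_rule rhat tie ->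
      let eps2 := eps_RM2 pi_ref rstar rhat x in
      let eps := eps_RM pi_ref rstar rhat x in
      let C := coverage pi_ref pi_star x in
      let L := ln (Rmax / eps)%R in
      let T := (Rmax%:E * C * L%:E / eps%:E) `^ (2 / 3) in
      (0 < eps2 <= 1)%R ->
      C1%:E * T <= N%:R%:E ->
      N%:R%:E <= C2%:E * T ->
      J rstar pi_star x - J rstar (BoN pi_ref tie) x
        <= c''%:E * (Rmax%:E * C * eps2%:E * L%:E) `^ (1 / 3)).

Proof.
split.
  exists 4%R, 3%R; split=> // X Y Rmax pi_ref rstar rhat N tie x pi_star.
  move=> R1 rsP rhP N0 tieP eps2 eps C L e01.
  exact: (BoN_regret_le R1 rsP rhP N0 tieP e01).
exists 4%R; split=> // C1 C2 C14 C12.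
exists (3 * (C1^-1 + Num.sqrt C2) + 1)%R; split.
  have C10 : (0 <= C1^-1)%R by rewrite invr_ge0 (le_trans _ C14).
  by rewrite ltr_wpDl// mulr_ge0// addr_ge0// sqrtr_ge0.
move=> X Y Rmax pi_ref rstar rhat N tie x pi_star R1 rsP rhP N0 tieP.
move=> eps2 eps C L T e01 lowN uppN.
exact: (BoN_regret_optimal_N R1 rsP rhP N0 tieP e01 C14 lowN uppN).
Qed.
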